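(* Let $\Omega$ be an algebra of subsets of a set $X$ and $\mu$ a measure on $\Omega$ with $\mu(X)<\infty$. Let $\overline{\Omega}$ be the completion of $\Omega$ under the pseudometric $d(A,B)=\mu^{\ast}(A\triangle B)$, with its operations $\bigcup,\bigcap,{}^{\mathbf C}$ and countable unions, let $\widetilde{\mathbf S}_{/\sim}$ be the set of $\sim$-classes of limits of $\mu$-Cauchy sequences, and let $F$ be the map sending $\overline{\{B_n\}}\in\overline{\Omega}$ to the $\sim$-class of $\overline{\lim}\, B_{f(n)}$ (all as defined in the context). Then $F$ is a $\sigma$-algebra isomorphism between $\overline{\Omega}$ and $\widetilde{\mathbf S}_{/\sim}$; that is, $F:\overline{\Omega}\to\widetilde{\mathbf S}_{/\sim}$ is one to one and onto, and for all $E,E',E_1,E_2,\ldots\in\overline{\Omega}$, $$F(E\textstyle\bigcup E')=F(E)\cup F(E'),\qquad F(E\bigcap E')=F(E)\cap F(E'),$$ $$F(E^{\mathbf C})=F(E)^{\mathbf C},\qquad F\Big(\bigcup_{i=1}^{\infty}E_i\Big)=\bigcup_{i=1}^{\infty}F(E_i).$$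
   Context: Let $X$ be a set, $\Omega$ an algebra of subsets of $X$ (containing $X$ and $\emptyset$, closed under complements and finite unions), and $\mu$ a measure on the algebra $\Omega$ (nonnegative, $\mu(\emptyset)=0$, countably additive whenever a countable disjoint union of members of $\Omega$ lies in $\Omega$) with $\mu(X)<\infty$. Let $\mathbf P(X)$ be the power set of $X$. Outer measure: $\mu^{\ast}(A)=\inf\{\sum_{i}\mu(A_i) : A\subseteq\bigcup_{i\ge 1}A_i,\ A_i\in\Omega \text{ for all } i\ge 1\}$ for $A\in\mathbf P(X)$. One has $\mu^{\ast}|_{\Omega}=\mu$. Write $A\sim B$ (or ''$A=B$ a.e.'') iff $\mu^{\ast}(A\triangle B)=0$. A $\mu$-Cauchy sequence is a sequence $\{B_n\}$ with $B_n\in\Omega$ and $\mu(B_n\triangle B_m)\to 0$ as $n,m\to\infty$. $\widetilde{\mathbf S}=\{S\in\mathbf P(X) : \text{there is a } \mu\text{-Cauchy sequence } \{B_n\} \text{ with } \lim_n\mu^{\ast}(B_n\triangle S)=0\}$. It is known that $\widetilde{\mathbf S}$ is a $\sigma$-algebra; unions, intersections, complements and countable unions on $\widetilde{\mathbf S}_{/\sim}$ are those induced from $\widetilde{\mathbf S}$ (they respect $\sim$). Completion: $\overline{\Omega}$ is the set of $\mu$-Cauchy sequences modulo the equivalence $\{A_n\}\sim\{B_n\}$ iff $\lim_n\mu(A_n\triangle B_n)=0$; the class of $\{B_n\}$ is $\overline{\{B_n\}}$. Put $\overline\mu(\overline{\{B_n\}})=\lim_n\mu(B_n)$. The following operations on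 $\overline{\Omega}$ are known to be well defined: $\overline{\{A_n\}}\bigcup\overline{\{B_n\}}=\overline{\{A_n\cup B_n\}}$, $\overline{\{A_n\}}\bigcap\overline{\{B_n\}}=\overline{\{A_n\cap B_n\}}$, $(\overline{\{B_n\}})^{\mathbf C}=\overline{\{B_n^{\mathbf C}\}}$. Write $E\subset E'$ in $\overline{\Omega}$ iff $E\bigcap E'=E$. For $E_i\in\overline{\Omega}$ ($i\ge 1$), $\bigcup_{i=1}^{\infty}E_i$ denotes the (known to exist) unique $E\in\overline{\Omega}$ such that $\bigcup_{i=1}^{n}E_i\subset E$ for all $n$ and $\lim_{n}\overline\mu\big(E\bigcap(\bigcup_{i=1}^{n}E_i)^{\mathbf C}\big)=0$. For a sequence of sets, $\overline{\lim}\, C_n=\bigcap_{m\ge 1}\bigcup_{n\ge m}C_n$. The map $F$: it is known that for every $\mu$-Cauchy sequence $\{B_n\}$ there is a function $f:\mathbb N\to\mathbb N$ with $f(n)>n$ for all $n$ such that $\lim_n\mu^{\ast}(B_n\triangle\overline{\lim}_k\, B_{f(k)})=0$. Define $F(\overline{\{B_n\}})=\overline{\lim}\, B_{f(n)}$ for any such $f$. This set lies in $\widetilde{\mathbf S}$ and its $\sim$-class does not depend on the choice of the representative $\{B_n\}$ or of $f$; $F$ is regarded as taking values in $\widetilde{\mathbf S}_{/\sim}$. *)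

(* Defs.v *)
From HB Require Import structures.
From mathcomp Require Import all_boot all_order all_algebra generic_quotient.
From mathcomp Require Import mathcomp_extra boolp classical_sets functions.
From mathcomp Require Import reals ereal topology normedtype sequences measure.

Set Implicit Arguments.
Unset Strict Implicit.
Unset Printing Implicit Defensive.

Import Order.TTheory GRing.Theory Num.Theory.
Import numFieldNormedType.Exports.

Local Open Scope classical_set_scope.
Local Open Scope ring_scope.
Local Open Scope ereal_scope.
Local Open Scope quotient_scope.
Local Open Scope measure_scope.

Section symmetric_difference.
Context {X : Type}.
Implicit Types A B C D : set X.

Lemma setY_trans_sub A B C : A `+` C `<=` (A `+` B) `|` (B `+` C).
Proof. by move=> x /=; have := EM (B x); tauto. Qed.

Lemma setYU_sub A B C D :
  (A `|` B) `+` (C `|` D) `<=` (A `+` C) `|` (B `+` D).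
Proof. by move=> x /=; have := EM (C x); have := EM (D x); tauto. Qed.

Lemma setYI_sub A B C D :
  (A `&` B) `+` (C `&` D) `<=` (A `+` C) `|` (B `+` D).
Proof.
move=> x /=; have := EM (A x); have := EM (B x); have := EM (C x).
by have := EM (D x); tauto.
Qed.

Lemma setYCC A B : ~` A `+` ~` B = A `+` B.
Proof.
by apply/seteqP; split=> x /=; have := EM (A x); have := EM (B x); tauto.
Qed.

Lemma setY_bigcup_sub (A B : nat -> set X) :
  (\bigcup_i A i) `+` (\bigcup_i B i) `<=` \bigcup_i (A i `+` B i).
Proof.
move=> x /= [[[i _ ABi] nB]|[[i _ ABi] nA]]; exists i => //=; [left|right];
  split=> // ABi'; by [apply: nB; exists i|apply: nA; exists i].
Qed.

End symmetric_difference.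

Section ae_classes.
Context d (T : algebraOfSetsType d) (R : realType).
Variable mu : {measure set T -> \bar R}.
Implicit Types A B C S : set T.

Lemma mu_ext_setY_sub A B C : C `<=` A `|` B -> mu^* C <= mu^* A + mu^* B.
Proof.
by move=> /(le_outer_measure mu^*) /le_trans; apply; exact: outer_measureU2.
Qed.

Definition ae_eq_set A B : bool := `[< mu^* (A `+` B) = 0 >].

Lemma ae_eq_set_refl : reflexive ae_eq_set.
Proof. by move=> A; apply/asboolP; rewrite setYK outer_measure0. Qed.

Lemma ae_eq_set_sym : symmetric ae_eq_set.
Proof. by move=> A B; rewrite /ae_eq_set setYC. Qed.

Lemma ae_eq_set_trans : transitive ae_eq_set.
Proof.
move=> B A C /asboolP AB /asboolP BC; apply/asboolP.
apply/eqP; rewrite eq_le outer_measure_ge0 andbT.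
by rewrite (le_trans (mu_ext_setY_sub (@setY_trans_sub _ A B C)))// AB BC adde0.
Qed.

Canonical ae_eq_set_equiv :=
  EquivRel ae_eq_set ae_eq_set_refl ae_eq_set_sym ae_eq_set_trans.

(* The quotient of the whole power set by equality a.e. The operations live
   here; the classes of limits of Cauchy sequences form the subset [limits_ae]
   below. A set equal a.e. to such a limit is itself one, so that the members
   of [limits_ae] are exactly the classes of the relation restricted to
   [limits]. *)
Definition setae := {eq_quot ae_eq_set}.
HB.instance Definition _ := Choice.on setae.
HB.instance Definition _ := EqQuotient.on setae.

Definition setae_union (c c' : setae) : setae := \pi_setae (repr c `|` repr c').
Definition setae_inter (c c' : setae) : setae := \pi_setae (repr c `&` repr c').
Definition setae_compl (c : setae) : setae := \pi_setae (~` repr c).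
Definition setae_bigcup (c : nat -> setae) : setae :=
  \pi_setae (\bigcup_i repr (c i)).

Lemma setaeP A B :
  \pi_setae A = \pi_setae B <-> mu^* (A `+` B) = 0.
Proof. by split=> [/eqmodP/asboolP|?]//; exact/eqmodP/asboolP. Qed.

Lemma repr_setae A : mu^* (repr (\pi_setae A) `+` A) = 0.
Proof. by apply/setaeP; rewrite reprK. Qed.

Lemma null_setY_sub A B C :
  C `<=` A `|` B -> mu^* A = 0 -> mu^* B = 0 -> mu^* C = 0.
Proof.
move=> /mu_ext_setY_sub CAB A0 B0; apply/eqP.
by rewrite eq_le outer_measure_ge0 andbT (le_trans CAB)// A0 B0 adde0.
Qed.

Lemma setae_unionE A B :
  setae_union (\pi_setae A) (\pi_setae B) = \pi_setae (A `|` B).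
Proof.
by apply/setaeP;
  apply: null_setY_sub (@setYU_sub _ _ _ _ _) _ _; exact: repr_setae.
Qed.

Lemma setae_interE A B :
  setae_inter (\pi_setae A) (\pi_setae B) = \pi_setae (A `&` B).
Proof.
by apply/setaeP;
  apply: null_setY_sub (@setYI_sub _ _ _ _ _) _ _; exact: repr_setae.
Qed.

Lemma setae_complE A : setae_compl (\pi_setae A) = \pi_setae (~` A).
Proof.
by apply/setaeP; rewrite setYCC repr_setae.
Qed.

Lemma setae_bigcupE (A : nat -> set T) :
  setae_bigcup (fun i => \pi_setae (A i)) = \pi_setae (\bigcup_i A i).
Proof.
apply/setaeP/eqP; rewrite eq_le outer_measure_ge0 andbT.
apply: le_trans (le_outer_measure mu^* _ _ (@setY_bigcup_sub _ _ _)) _.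
apply: le_trans (outer_measure_sigma_subadditive _ _) _.
by rewrite eseries0// => i _ _; exact: repr_setae.
Qed.

Definition mu_cauchy (B : nat -> set T) :=
  (forall n, measurable (B n)) /\
  mu (B nm.1 `+` B nm.2) @[nm --> (\oo, \oo)] --> 0.

Definition limits : set (set T) :=
  [set S | exists2 B : nat -> set T, mu_cauchy B &
           mu^* (B n `+` S) @[n --> \oo] --> 0].

Definition limits_ae : set setae := [set \pi_setae S | S in limits].

End ae_classes.

Arguments limits {d T R} mu.
Arguments limits_ae {d T R} mu.

Section completion.
Context d (T : algebraOfSetsType d) (R : realType).
Variable mu : {measure set T -> \bar R}.

Lemma squeeze_setY I (G : set_system I) {FG : Filter G} (A B C : I -> set T) :
  (forall i, measurable (A i)) -> (forall i, measurable (B i)) ->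
  (forall i, measurable (C i)) -> (forall i, C i `<=` A i `|` B i) ->
  mu (A i) @[i --> G] --> 0 -> mu (B i) @[i --> G] --> 0 ->
  mu (C i) @[i --> G] --> 0.
Proof.
move=> mA mB mC CAB A0 B0.
have AB0 : mu (A i) + mu (B i) @[i --> G] --> 0.
  by rewrite -[X in _ --> X]adde0; exact: cvgeD.
apply: squeeze_cvge (@cvg_cst _ 0 _ G _) AB0; apply: nearW => i.
rewrite measure_ge0/= -!measurable_mu_extE//; exact: mu_ext_setY_sub.
Qed.

Lemma measurable_setY (A B : set T) :
  measurable A -> measurable B -> measurable (A `+` B).
Proof. by move=> mA mB; apply: measurableU; exact: measurableD. Qed.

Record cauchy_seq := CauchySeq {
  cauchy_fun :> nat -> set T ;
  cauchy_funP : mu_cauchy mu cauchy_fun }.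

HB.instance Definition _ := gen_eqMixin cauchy_seq.
HB.instance Definition _ := gen_choiceMixin cauchy_seq.

Implicit Types A B C : cauchy_seq.

Lemma cauchy_measurable A n : measurable (A n).
Proof. by case: A => A []. Qed.
Local Hint Resolve cauchy_measurable : core.

Lemma mu_cauchy_set0 : mu_cauchy mu (fun=> set0).
Proof.
split=> [_|]; first exact: measurable0.
by rewrite setYK measure0; exact: cvg_cst.
Qed.

Lemma mu_cauchyU A B : mu_cauchy mu (fun n => A n `|` B n).
Proof.
split=> [n|]; first exact: measurableU.
apply: squeeze_setY (cauchy_funP A).2 (cauchy_funP B).2 => nm.
- exact: measurable_setY.
- exact: measurable_setY.
- by apply: measurable_setY; exact: measurableU.
- exact: setYU_sub.
Qed.

Lemma mu_cauchyI A B : mu_cauchy mu (fun n => A n `&` B n).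
Proof.
split=> [n|]; first exact: measurableI.
apply: squeeze_setY (cauchy_funP A).2 (cauchy_funP B).2 => nm.
- exact: measurable_setY.
- exact: measurable_setY.
- by apply: measurable_setY; exact: measurableI.
- exact: setYI_sub.
Qed.

Lemma mu_cauchyC A : mu_cauchy mu (fun n => ~` A n).
Proof.
split=> [n|]; first exact: measurableC.
under eq_fun do rewrite setYCC.
exact: (cauchy_funP A).2.
Qed.

Definition cauchy0 := CauchySeq mu_cauchy_set0.
Definition cauchyU A B := CauchySeq (mu_cauchyU A B).
Definition cauchyI A B := CauchySeq (mu_cauchyI A B).
Definition cauchyC A := CauchySeq (mu_cauchyC A).

Definition cauchy_equiv A B : bool :=
  `[< mu (A n `+` B n) @[n --> \oo] --> 0 >].

Lemma cauchy_equiv_refl : reflexive cauchy_equiv.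
Proof.
move=> A; apply/asboolP; under eq_fun do rewrite setYK measure0.
exact: cvg_cst.
Qed.

Lemma cauchy_equiv_sym : symmetric cauchy_equiv.
Proof.
by move=> A B; rewrite /cauchy_equiv; under eq_fun do rewrite setYC.
Qed.

Lemma cauchy_equiv_trans : transitive cauchy_equiv.
Proof.
move=> B A C /asboolP AB /asboolP BC; apply/asboolP.
apply: squeeze_setY AB BC => n.
- exact: measurable_setY.
- exact: measurable_setY.
- exact: measurable_setY.
- exact: setY_trans_sub.
Qed.

Canonical cauchy_equiv_equiv := EquivRel cauchy_equiv
  cauchy_equiv_refl cauchy_equiv_sym cauchy_equiv_trans.

Definition completion := {eq_quot cauchy_equiv}.
HB.instance Definition _ := Choice.on completion.
HB.instance Definition _ := EqQuotient.on completion.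

Implicit Types E : completion.

Definition completion_union E E' : completion :=
  \pi_completion (cauchyU (repr E) (repr E')).
Definition completion_inter E E' : completion :=
  \pi_completion (cauchyI (repr E) (repr E')).
Definition completion_compl E : completion := \pi_completion (cauchyC (repr E)).
Definition completion0 : completion := \pi_completion cauchy0.

Lemma completionP A B : \pi_completion A = \pi_completion B <->
  mu (A n `+` B n) @[n --> \oo] --> 0.
Proof. by split=> [/eqmodP/asboolP|?]//; exact/eqmodP/asboolP. Qed.

Lemma repr_completion A :
  mu (repr (\pi_completion A) n `+` A n) @[n --> \oo] --> 0.
Proof. by apply/completionP; rewrite reprK. Qed.

Lemma completion_unionE A B :
  completion_union (\pi_completion A) (\pi_completion B) =
  \pi_completion (cauchyU A B).
Proof.
apply/completionP.
apply: squeeze_setY (repr_completion A) (repr_completion B) => n.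
- exact: measurable_setY.
- exact: measurable_setY.
- exact: measurable_setY.
- exact: setYU_sub.
Qed.

Lemma completion_interE A B :
  completion_inter (\pi_completion A) (\pi_completion B) =
  \pi_completion (cauchyI A B).
Proof.
apply/completionP.
apply: squeeze_setY (repr_completion A) (repr_completion B) => n.
- exact: measurable_setY.
- exact: measurable_setY.
- exact: measurable_setY.
- exact: setYI_sub.
Qed.

Lemma completion_complE A :
  completion_compl (\pi_completion A) = \pi_completion (cauchyC A).
Proof.
apply/completionP => /=.
under eq_fun do rewrite setYCC.
exact: repr_completion.
Qed.

Definition completion_mu E : \bar R := lim (mu (repr E n) @[n --> \oo]).

Definition completion_sub E E' : Prop := completion_inter E E' = E.

Definition completion_partial_union (Es : nat -> completion) n : completion :=
  \big[completion_union/completion0]_(i < n.+1) Es i.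

Definition is_completion_bigcup (Es : nat -> completion) E : Prop :=
  (forall n, completion_sub (completion_partial_union Es n) E) /\
  completion_mu
    (completion_inter E (completion_compl (completion_partial_union Es n)))
    @[n --> \oo] --> 0.

(* [xget] returns its first argument if no element satisfies the predicate;
   this does not happen when the measure is finite, and then the element is
   unique. *)
Definition completion_bigcup (Es : nat -> completion) : completion :=
  xget completion0 [set E | is_completion_bigcup Es E].

Definition is_limsup_class E (c : setae mu) : Prop :=
  exists (B : cauchy_seq) (f : nat -> nat),
    [/\ \pi_completion B = E, forall n, (n < f n)%N,
        mu^* (B n `+` lim_sup_set (fun k => B (f k))) @[n --> \oo] --> 0 &
        c = \pi_(setae mu) (lim_sup_set (fun k => B (f k)))].

(* As for [completion_bigcup], the default value is never used when the measure
   is finite: such a class exists and is unique. *)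
Definition limsup_map E : setae mu :=
  xget (\pi_(setae mu) set0) [set c | is_limsup_class E c].

End completion.

(* Main.v *)
Require Import Defs.
From mathcomp Require Import all_boot all_order all_algebra generic_quotient.
From mathcomp Require Import boolp classical_sets functions.
From mathcomp Require Import reals ereal topology normedtype sequences measure.

Set Implicit Arguments.
Unset Strict Implicit.
Unset Printing Implicit Defensive.

Import Order.TTheory GRing.Theory Num.Theory.
Import numFieldNormedType.Exports.

Local Open Scope classical_set_scope.
Local Open Scope ring_scope.
Local Open Scope ereal_scope.

(** Everything reduces to one relation between a point [E] of the completion
    and a set [S]: [represents E S] says that the sequences in the class [E]
    converge to [S] for the outer measure, i.e. that the outer measure of
    [B n `+` S] tends to 0. By the triangle inequality for symmetric
    differences this relation does not depend on the chosen sequence, it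
    determines [S] up to a null set, and it determines [E]. Every [E] represents
    some set ([cauchy_lim_sup_set]): along a subsequence with summable
    successive distances, a point that lies in exactly one of [C n] and the
    upper limit of [C] must see membership flip after time [n], and the sets
    where this happens have total outer measure at most the tail of the series.
    Hence [limsup_map E] is the class of [S] exactly when [represents E S]
    ([represents_limsup_map]). Injectivity, surjectivity onto the limits, and
    compatibility with each operation become statements about [represents];
    for union, intersection and complement they follow at once from the
    inclusions bounding the symmetric difference of two results.

    Up to this point subadditivity of the outer measure and its agreement with
    [mu] on measurable sets suffice; countable unions require additivity of the
    outer measure on limits. Limits of Cauchy sequences are Caratheodory
    measurable ([limit_caratheodory]), and the outer measure restricted to
    Caratheodory measurable sets is a measure, finite here; continuity from
    above makes the finite unions of the represented sets
    converge to their countable union ([outer_bigcup_tail]). A diagonal choice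
    of measurable approximations of these finite unions then produces a point of
    the completion that represents the countable union
    ([bigcup_represented]). Finally, the inclusions and the limit that define
    the union in the completion say, in terms of a represented set [T], that
    the two differences between [T] and the countable union are null
    ([is_completion_bigcupE]). *)

Section extended_limits.
Context {R : realType}.

Lemma cvge0_lt I (G : set_system I) {FG : Filter G} (u : I -> \bar R) (e : R) :
  u i @[i --> G] --> 0 -> (0 < e)%R -> \forall i \near G, u i < e%:E.
Proof.
move=> /fine_cvgP[ufin u0] e0.
have : \forall i \near G, (fine (u i) < e)%R by apply: cvgr_lt u0 _ e0.
by apply: filterS2 ufin => i fi; rewrite -lte_fin fineK.
Qed.

End extended_limits.

Section symmetric_difference_series.
Context {X : Type}.
Implicit Types C : nat -> set X.

Lemma notin_setY_bigcup C n k x :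
  ~ (\bigcup_(j in ~` `I_n) (C j `+` C j.+1)) x -> (n <= k)%N ->
  C n x <-> C k x.
Proof.
move=> noflip; elim: k => [|k IHk]; first by rewrite leqn0 => /eqP ->.
rewrite leq_eqVlt ltnS => /predU1P[-> //|nk]; apply: (iff_trans (IHk nk)).
have : ~ (C k `+` C k.+1) x.
  by move=> kx; apply: noflip; exists k => //=; apply/negP; rewrite -leqNgt.
by move=> /=; have := EM (C k x); have := EM (C k.+1 x); tauto.
Qed.

(** If membership of [x] never flips from time [n] on, then [x] lies either in
    all terms from [C n] on or in none of them, and so it lies in the upper
    limit exactly when it lies in [C n]. *)
Lemma setY_lim_sup_set_sub C n :
  C n `+` lim_sup_set C `<=` \bigcup_(j in ~` `I_n) (C j `+` C j.+1).
Proof.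
move=> x Cx; apply: contrapT => noflip; have same := notin_setY_bigcup noflip.
case: Cx => -[] => [Cnx|limx].
- apply=> m _; exists (maxn m n); first exact: leq_maxl.
  by apply/same => //; exact: leq_maxr.
- have [k /= nk Ckx] := limx n I.
  by apply; apply/(same k).
Qed.

End symmetric_difference_series.

(** * Limits of Cauchy sequences *)

Section limits_of_cauchy_sequences.
Local Open Scope measure_scope.
Context d (X : algebraOfSetsType d) (R : realType).
Variable mu : {measure set X -> \bar R}.
Implicit Types (B C : nat -> set X) (S T U : set X).

Lemma squeeze_outer I (G : set_system I) {FG : Filter G} (A B C : I -> set X) :
  (forall i, C i `<=` A i `|` B i) ->
  mu^* (A i) @[i --> G] --> 0 -> mu^* (B i) @[i --> G] --> 0 ->
  mu^* (C i) @[i --> G] --> 0.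
Proof.
move=> CAB A0 B0.
have AB0 : mu^* (A i) + mu^* (B i) @[i --> G] --> 0.
  by rewrite -[X in _ --> X]adde0; exact: cvgeD.
apply: squeeze_cvge (@cvg_cst _ 0 _ G _) AB0; apply: nearW => i.
by rewrite outer_measure_ge0/=; exact: mu_ext_setY_sub.
Qed.

Lemma outer_cvg_cst0 S : mu^* S @[_ --> \oo] --> 0 -> mu^* S = 0.
Proof.
by move=> S0; apply: (cvg_unique (@ereal_hausdorff R) _ S0); exact: cvg_cst.
Qed.

Lemma outer_setYE S T : measurable S -> measurable T ->
  mu^* (S `+` T) = mu (S `+` T).
Proof. by move=> mS mT; exact/measurable_mu_extE/measurable_setY. Qed.

(** Thanks to this, any measurable approximation of a set yields a point of the
    completion, without a separate proof of the Cauchy property. *)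
Lemma limit_cauchy B S : (forall n, measurable (B n)) ->
  mu^* (B n `+` S) @[n --> \oo] --> 0 -> mu_cauchy mu B.
Proof.
move=> mB BS; split=> //.
under eq_fun do rewrite -outer_setYE//.
apply: (@squeeze_outer _ _ _ (fun nm => B nm.1 `+` S) (fun nm => S `+` B nm.2)).
- by move=> nm; exact: setY_trans_sub.
- exact: (cvg_comp fst (fun n => mu^* (B n `+` S)) cvg_fst BS).
- under eq_fun do rewrite setYC.
  exact: (cvg_comp snd (fun n => mu^* (B n `+` S)) cvg_snd BS).
Qed.

Lemma cauchy_modulus B : mu_cauchy mu B -> forall e : R, (0 < e)%R ->
  exists N, forall n m, (N <= n)%N -> (N <= m)%N -> mu (B n `+` B m) < e%:E.
Proof.
move=> [_ cB] e e0; have [[P Q] /= [[N _ NP] [M _ MQ]] PQ] := cvge0_lt cB e0.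
exists (maxn N M) => n m; rewrite !geq_max => /andP[Nn _] /andP[_ Mm].
by apply: (PQ (n, m)); split; [exact: NP|exact: MQ].
Qed.

Lemma cauchy_fast_subsequence B : mu_cauchy mu B ->
  exists2 f : nat -> nat, (forall n, n < f n)%N &
    \sum_(n <oo) mu (B (f n) `+` B (f n.+1)) < +oo.
Proof.
move=> cB; have e0 n : (0 < 1 / (2 ^ n.+1)%:R :> R)%R.
  by rewrite divr_gt0// ltr0n expn_gt0.
have [g gP] := choice (fun n => cauchy_modulus cB (e0 n)).
(* The running sum makes f nondecreasing, so that both f n and f n.+1 lie
   beyond the modulus g n. *)
pose f n := (n.+1 + \sum_(i < n.+1) g i)%N.
have gf n : (g n <= f n)%N.
  by rewrite /f big_ord_recr/= addnA leq_addl.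
have ff n : (f n <= f n.+1)%N.
  by rewrite leq_add// [leqRHS]big_ord_recr leq_addr.
exists f; first by move=> n; rewrite /f addSn ltnS leq_addr.
apply: le_lt_trans (ltry 1); apply: le_trans (epsilon_trick0 xpredT ler01).
apply: lee_nneseries => n _; first by move=> _; exact: measure_ge0.
by apply/ltW/gP => //; exact: leq_trans (ff n).
Qed.

(** The requirement [n < f n] serves twice: it is part of the definition of the
    isomorphism, and it makes [B n] and [B (f n)] close by the Cauchy
    property. *)
Lemma cauchy_lim_sup_set B : mu_cauchy mu B ->
  exists2 f : nat -> nat, (forall n, n < f n)%N &
    mu^* (B n `+` lim_sup_set (fun k => B (f k))) @[n --> \oo] --> 0.
Proof.
move=> cB; have [f nf sumf] := cauchy_fast_subsequence cB; exists f => //.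
have mB n : measurable (B n) := cB.1 n.
pose C k := B (f k).
apply: (@squeeze_outer _ _ _ (fun n => B n `+` C n)
                             (fun n => C n `+` lim_sup_set C)).
- by move=> n; exact: setY_trans_sub.
- under eq_fun => n do rewrite (outer_setYE (mB n) (mB (f n))).
  have foo : f n @[n --> \oo] --> \oo.
    apply/cvgnyPge => A; near=> n; apply: (leq_trans _ (ltnW (nf n))).
    by near: n; exact: nbhs_infty_ge.
  exact: (cvg_comp _ _ (cvg_pair cvg_id foo) cB.2).
- have tail0 := nneseries_tail_cvg sumf (fun k _ => measure_ge0 mu _).
  apply: squeeze_cvge (@cvg_cst _ 0 _ \oo _) tail0; apply: nearW => n.
  rewrite outer_measure_ge0/=.
  apply: le_trans (le_outer_measure mu^* _ _ (@setY_lim_sup_set_sub _ C n)) _.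
  apply: le_trans (outer_measure_sigma_subadditive_tail _ _ _) _.
  apply: lee_nneseries => k _; first by move=> _; exact: outer_measure_ge0.
  by rewrite [leLHS]outer_setYE; [exact: lexx|exact: mB|exact: mB].
Unshelve. all: by end_near. Qed.

(** Replacing a Caratheodory measurable [B n] by [S] changes each of the two
    terms of the Caratheodory splitting by at most the outer measure of
    [B n `+` S], which is arbitrarily small. *)
Lemma limit_caratheodory B S : (forall n, measurable (B n)) ->
  mu^* (B n `+` S) @[n --> \oo] --> 0 -> mu^*.-caratheodory S.
Proof.
move=> mB BS; apply: le_caratheodory_measurable => Y.
apply/lee_addgt0Pr => e e0.
have e20 : (0 < e / 2)%R by rewrite divr_gt0.
have [n _ /(_ n (leqnn n))/= nBS] := cvge0_lt BS e20.
have cB : mu^*.-caratheodory (B n).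
  by apply: sub_caratheodory; exact: sub_sigma_algebra.
rewrite (cB Y) (splitr e) EFinD addeACA.
by apply: leeD; (apply: le_trans (leeD2l _ (ltW nBS));
  apply: mu_ext_setY_sub => x /=; have := EM (B n x); tauto).
Qed.

End limits_of_cauchy_sequences.

(** * Sets represented by points of the completion *)

Section represented_sets.
Local Open Scope measure_scope.
Local Open Scope quotient_scope.
Context d (X : algebraOfSetsType d) (R : realType).
Variable mu : {measure set X -> \bar R}.
Implicit Types (A B : cauchy_seq mu) (E : completion mu) (S T : set X).

Local Hint Resolve cauchy_measurable : core.

(** Convergence is asked of the canonical representative only; [represents_pi]
    transfers it to every sequence of the class. *)
Definition represents E S := mu^* (repr E n `+` S) @[n --> \oo] --> 0.

Lemma represents_pi B S :
  represents (\pi_(completion mu) B) S <->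
  mu^* (B n `+` S) @[n --> \oo] --> 0.
Proof.
have BB : mu^* (repr (\pi_(completion mu) B) n `+` B n) @[n --> \oo] --> 0.
  by under eq_fun do rewrite outer_setYE//; exact: repr_completion.
split=> [|BS]; last first.
  exact: squeeze_outer (fun n => @setY_trans_sub _ _ _ _) BB BS.
apply: squeeze_outer (fun n => @setY_trans_sub _ _ _ _) _.
by under eq_fun do rewrite setYC.
Qed.

Lemma represents_ae E S T : represents E S -> mu^* (S `+` T) = 0 ->
  represents E T.
Proof.
move=> ES ST; apply: squeeze_outer (fun n => @setY_trans_sub _ _ _ _) ES _.
by under eq_fun do rewrite ST; exact: cvg_cst.
Qed.

Lemma represents_uniq E S T : represents E S -> represents E T ->
  mu^* (S `+` T) = 0.
Proof.
move=> ES ET; apply: outer_cvg_cst0.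
apply: (squeeze_outer (B := fun n => repr E n `+` T)) _ ET.
- by move=> n; exact: setY_trans_sub.
- by under eq_fun do rewrite setYC; exact: ES.
Qed.

Lemma represents_inj E E' S : represents E S -> represents E' S -> E = E'.
Proof.
move=> ES E'S; rewrite -(reprK E) -(reprK E'); apply/completionP.
under eq_fun do rewrite -outer_setYE//.
apply: squeeze_outer (fun n => @setY_trans_sub _ _ _ _) ES _.
by under eq_fun do rewrite setYC; exact: E'S.
Qed.

Lemma represents_exists E : exists S, represents E S.
Proof.
have [f _ fE] := cauchy_lim_sup_set (cauchy_funP (repr E)).
by exists (lim_sup_set (fun k => repr E (f k))).
Qed.

Lemma limit_represented (B : nat -> set X) S : (forall n, measurable (B n)) ->
  mu^* (B n `+` S) @[n --> \oo] --> 0 -> exists E, represents E S.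
Proof.
move=> mB BS; exists (\pi_(completion mu) (CauchySeq (limit_cauchy mB BS))).
exact/represents_pi.
Qed.

(** The bridge between the map and [represents]: whatever sequence and
    subsequence are used to compute the upper limit, it is represented by [E],
    and represented sets are unique up to null sets. *)
Lemma represents_limsup_map E S :
  limsup_map E = \pi_(setae mu) S <-> represents E S.
Proof.
have classP c : is_limsup_class E c -> exists2 T, represents E T &
    c = \pi_(setae mu) T.
  by move=> [B [f [<- _ BT ->]]]; eexists; [exact/represents_pi/BT|].
have [T ET ->] : exists2 T, represents E T & limsup_map E = \pi_(setae mu) T.
  apply: classP; apply: xgetPex.
  have [f nf fS] := cauchy_lim_sup_set (cauchy_funP (repr E)).
  by eexists; exists (repr E), f; split=> //; exact: reprK.
split=> [/setaeP|ES]; first exact: represents_ae.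
exact/setaeP/(represents_uniq ET ES).
Qed.

Lemma limsup_map_inj : injective (@limsup_map _ _ _ mu).
Proof.
move=> E E' EE'; have [S E'S] := represents_exists E'.
apply: (@represents_inj _ _ S) => //.
by apply/represents_limsup_map; rewrite EE'; exact/represents_limsup_map.
Qed.

Lemma represents_union E E' S S' : represents E S -> represents E' S' ->
  represents (completion_union E E') (S `|` S').
Proof.
by move=> ES E'S'; apply/represents_pi;
  exact: squeeze_outer (fun n => @setYU_sub _ _ _ _ _) ES E'S'.
Qed.

Lemma represents_inter E E' S S' : represents E S -> represents E' S' ->
  represents (completion_inter E E') (S `&` S').
Proof.
by move=> ES E'S'; apply/represents_pi;
  exact: squeeze_outer (fun n => @setYI_sub _ _ _ _ _) ES E'S'.
Qed.

Lemma represents_compl E S : represents E S ->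
  represents (completion_compl E) (~` S).
Proof.
by move=> ES; apply/represents_pi => /=; under eq_fun do rewrite setYCC.
Qed.

Lemma represents0 : represents (completion0 mu) set0.
Proof.
apply/represents_pi => /=; under eq_fun do rewrite setYK outer_measure0.
exact: cvg_cst.
Qed.

Lemma represents_partial_union (Es : nat -> completion mu) (S : nat -> set X) :
  (forall i, represents (Es i) (S i)) -> forall n,
  represents (completion_partial_union Es n) (\bigcup_(i < n.+1) S i).
Proof.
move=> EsS n; rewrite bigcup_mkord; apply: (big_ind2 represents).
- exact: represents0.
- by move=> *; exact: represents_union.
- by move=> i _.
Qed.

Lemma represents_sub E E' S S' : represents E S -> represents E' S' ->
  completion_sub E E' <-> mu^* (S `\` S') = 0.
Proof.
move=> ES E'S'; have EI := represents_inter ES E'S'.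
have <- : (S `&` S') `+` S = S `\` S'.
  by apply/seteqP; split=> x /=; have := EM (S' x); tauto.
split=> [EE'|SS']; first by rewrite EE' in EI; exact: represents_uniq EI ES.
by apply: represents_inj ES; exact: represents_ae EI SS'.
Qed.

Lemma represents_caratheodory E S : represents E S -> mu^*.-caratheodory S.
Proof. by apply: limit_caratheodory. Qed.

(** * Countable unions in the completion *)

Hypothesis mu_fin : mu [set: X] < +oo.

Lemma outer_fin_num S : mu^* S \is a fin_num.
Proof.
rewrite ge0_fin_numE ?outer_measure_ge0//; apply: le_lt_trans mu_fin.
by rewrite -measurable_mu_extE//; exact: le_outer_measure.
Qed.

(** The outer measures of [repr E n] and [S] differ by at most that of their
    symmetric difference. *)
Lemma completion_mu_represents E S : represents E S -> completion_mu E = mu^* S.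
Proof.
move=> ES; apply: cvg_lim => //.
pose r n := mu^* (repr E n `+` S).
apply: (@squeeze_cvge _ _ _ _ (fun n => mu^* S - r n) _
                              (fun n => mu^* S + r n)).
- apply: nearW => n; rewrite -(measurable_mu_extE mu)//.
  rewrite leeBlDr ?outer_fin_num//.
  by apply/andP; split; apply: mu_ext_setY_sub => x /=;
    have := EM (repr E n x); have := EM (S x); tauto.
- rewrite -[X in _ --> X]sube0; apply: cvgeB; [|exact: cvg_cst|exact: ES].
  by rewrite fin_num_adde_defr ?outer_fin_num.
- rewrite -[X in _ --> X]adde0; apply: cvgeD; [|exact: cvg_cst|exact: ES].
  by rewrite fin_num_adde_defr ?outer_fin_num.
Qed.

(** The outer measure is a finite measure on the Caratheodory sigma-algebra,
    hence continuous from above along the decreasing remainders, whose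
    intersection is empty. *)
Lemma outer_bigcup_tail (S : nat -> set X) :
  (forall i, mu^*.-caratheodory (S i)) ->
  mu^* ((\bigcup_i S i) `\` \bigcup_(i < n.+1) S i) @[n --> \oo] --> 0.
Proof.
move=> cS.
pose D n : set (caratheodory_type mu^*) :=
  (\bigcup_i S i) `\` \bigcup_(i < n.+1) S i.
have mD n : measurable (D n).
  by apply: measurableD; apply: bigcup_measurable => i _; exact: cS.
have D0 : \bigcap_n D n = set0.
  rewrite -subset0 => x Dx; have [[i _ Six] _] := Dx 0%N I.
  by have [_ []] := Dx i I; exists i => /=.
pose nu : {measure set (caratheodory_type mu^*) -> \bar R} :=
  @completed_measure_extension _ _ _ mu.
have : nu (D n) @[n --> \oo] --> nu (\bigcap_n D n).
  apply: nonincreasing_cvg_mu => //.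
  - by rewrite -ge0_fin_numE ?outer_measure_ge0 ?outer_fin_num.
  - exact: bigcap_measurable.
  - move=> n m nm; apply/subsetPset => x [Ux Nx]; split=> // -[i /= im Six].
    by apply: Nx; exists i => //=; exact: leq_trans im _.
by rewrite D0 measure0.
Qed.

(** Let [E] represent [T] and let [U] be the union of the [S i]. The inclusions
    of the partial unions in [E] make each [S i `\` T] null, hence [U `\` T] by
    countable subadditivity; the limit condition makes [T `\` U] null, as it is
    contained in every remainder of [T]. So the defining property of the union
    in the completion amounts to [T] being [U] up to a null set, which also
    gives its uniqueness. *)
Lemma is_completion_bigcupE (Es : nat -> completion mu) (S : nat -> set X) E :
  (forall i, represents (Es i) (S i)) ->
  is_completion_bigcup Es E <-> represents E (\bigcup_i S i).
Proof.
move=> EsS; set U := \bigcup_i S i.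
have cS i := represents_caratheodory (EsS i).
have PS := represents_partial_union EsS.
have [T ET] := represents_exists E.
have subE n : completion_sub (completion_partial_union Es n) E <->
    mu^* (\bigcup_(i < n.+1) S i `\` T) = 0.
  exact: represents_sub.
have muE n : completion_mu
    (completion_inter E (completion_compl (completion_partial_union Es n))) =
    mu^* (T `\` \bigcup_(i < n.+1) S i).
  by apply: completion_mu_represents; apply/represents_inter/represents_compl.
rewrite /is_completion_bigcup; under eq_fun do rewrite muE.
split=> [[sub_E cvgE]|EU].
- apply: represents_ae ET _; rewrite setYC.
  apply: (@null_setY_sub _ _ _ mu (U `\` T) (T `\` U)) => //.
  + apply/eqP; rewrite eq_le outer_measure_ge0 andbT.
    have -> : U `\` T = \bigcup_i (S i `\` T) by rewrite setDE setI_bigcupl.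
    apply: le_trans (outer_measure_sigma_subadditive _ _) _.
    rewrite eseries0// => i _ _; apply/eqP.
    rewrite eq_le outer_measure_ge0 andbT.
    rewrite -(iffLR (subE i) (sub_E i)); apply: le_outer_measure.
    by apply: setSD => x Six; exists i => /=.
  + apply: outer_cvg_cst0; apply: (squeeze_outer _ cvgE cvgE) => n.
    by rewrite setUid; apply: setDS => x [i _ Six]; exists i.
- have TU : mu^* (T `+` U) = 0 := represents_uniq ET EU.
  split=> [n|].
  + apply/subE/eqP; rewrite eq_le outer_measure_ge0 andbT -TU.
    apply: le_outer_measure => x [[i _ Six] nTx]; right; split=> //.
    by exists i.
  + have tail := outer_bigcup_tail cS.
    apply: (squeeze_outer (B := fun=> T `+` U)) tail _; last first.
      by rewrite TU; exact: cvg_cst.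
    by move=> n x /=; have := EM (U x); rewrite /U/=; tauto.
Qed.

(** Diagonal argument: pick a measurable set [V n] within [1 / n.+1] of the
    union of the first [n.+1] sets; these unions converge to the countable
    union, hence so do the [V n]. *)
Lemma bigcup_represented (Es : nat -> completion mu) (S : nat -> set X) :
  (forall i, represents (Es i) (S i)) ->
  exists E, represents E (\bigcup_i S i).
Proof.
move=> EsS; pose T n := \bigcup_(i < n.+1) S i.
have approx n : exists V, measurable V /\ mu^* (V `+` T n) < n.+1%:R^-1%:E.
  have n0 : (0 < n.+1%:R^-1 :> R)%R by rewrite invr_gt0.
  have [k _ /(_ k (leqnn k))/= kT] :=
    cvge0_lt (represents_partial_union EsS n) n0.
  by exists (repr (completion_partial_union Es n) k); split.
have [V mVT] := choice approx.
apply: (@limit_represented V) => [n|]; first exact: (mVT n).1.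
apply: squeeze_outer (fun n => @setY_trans_sub _ _ (T n) _) _ _.
- apply: (@squeeze_cvge _ _ _ _ (cst 0) _ (fun n => n.+1%:R^-1%:E)).
  + by apply: nearW => n; rewrite outer_measure_ge0/= ltW//; exact: (mVT n).2.
  + exact: cvg_cst.
  + by apply: cvg_EFin; [exact: nearW|exact: cvg_harmonic].
- have tail := outer_bigcup_tail (fun i => represents_caratheodory (EsS i)).
  apply: (squeeze_outer _ tail tail) => n; rewrite setUid.
  move=> x [[[i _ Six] nUx]|//]; case: nUx; by exists i.
Qed.

Lemma represents_bigcup (Es : nat -> completion mu) (S : nat -> set X) :
  (forall i, represents (Es i) (S i)) ->
  represents (completion_bigcup Es) (\bigcup_i S i).
Proof.
move=> EsS; apply/(is_completion_bigcupE _ EsS); apply: xgetPex.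
by have [E EU] := bigcup_represented EsS; exists E; apply/is_completion_bigcupE.
Qed.

End represented_sets.

(** * The isomorphism *)

Theorem theorem2 (d : measure_display) (X : algebraOfSetsType d) (R : realType)
    (mu : {measure set X -> \bar R}) (mu_fin : mu [set: X] < +oo) :
  [/\ set_bij [set: completion mu] (limits_ae mu) (@limsup_map _ _ _ mu),
      forall E E' : completion mu,
        limsup_map (completion_union E E') =
        setae_union (limsup_map E) (limsup_map E'),
      forall E E' : completion mu,
        limsup_map (completion_inter E E') =
        setae_inter (limsup_map E) (limsup_map E'),
      forall E : completion mu,
        limsup_map (completion_compl E) = setae_compl (limsup_map E) &
      forall Es : nat -> completion mu,
        limsup_map (completion_bigcup Es) =
        setae_bigcup (fun i => limsup_map (Es i))].
Proof.
(* The operations on classes are computed on canonical representatives, so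
   these are the represented sets to use throughout. *)
have repE E : represents E (repr (limsup_map E)).
  by apply/represents_limsup_map; rewrite reprK.
split.
- split.
  + move=> E _; exists (repr (limsup_map E)); last by rewrite reprK.
    by exists (repr E); [exact: cauchy_funP|exact: repE].
  + by move=> E E' _ _; exact: limsup_map_inj.
  + move=> _ [S [B [mB cB] BS] <-].
    by have [E ES] := limit_represented mB BS; exists E => //;
      exact/represents_limsup_map.
- by move=> E E'; apply/represents_limsup_map; exact: represents_union.
- by move=> E E'; apply/represents_limsup_map; exact: represents_inter.
- by move=> E; apply/represents_limsup_map; exact: represents_compl.
- by move=> Es; apply/represents_limsup_map; exact: represents_bigcup.
Qed.
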